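(* Let $G$ be a finite abelian group (written additively, with identity $1_G$), $m$ a positive integer, and $f:G\to\mathbb{Z}_m$ a generalized bent function. Let $C_m$ be the multiplicative cyclic group of order $m$ with generator $g$, and for $x\in G$ let $E_x=\sum_{y\in G}g^{f(x+y)-f(y)}\in\mathbb{Z}[C_m]$. Then for every character $\tau$ of $C_m$ of order $m$ (extended linearly to $\mathbb{Z}[C_m]$), we have $\tau(E_x)=0$ for all $x\in G\setminus\{1_G\}$.
   Context: A function $f:G\to\mathbb{Z}_m$ on a finite abelian group $G$ is a generalized bent function (GBF) if $\left|\sum_{x\in G}\zeta_m^{f(x)}\chi(x)\right|^2=|G|$ for every character $\chi$ of $G$, where $\zeta_m$ is a primitive $m$-th root of unity. *)

(* Defs.v *)
From mathcomp Require Import all_boot all_order all_algebra all_fingroup.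
From mathcomp Require Import all_solvable all_field all_character.

Set Implicit Arguments.
Unset Strict Implicit.
Unset Printing Implicit Defensive.

Import Order.TTheory GRing.Theory Num.Theory.
Local Open Scope ring_scope.

(* Z/mZ for every m >= 1, with the canonical additive structure of 'I_n.+1.
   The library's 'Z_m is not used because 'Z_1 is Z/2Z. *)
Notation Zmod m := 'I_m.-1.+1.

(* The characters of G are the linear characters of [set: G], where the group
   law on a finZmodType is its addition. Complex numbers are in algC, which
   contains all roots of unity. *)
Definition generalized_bent (G : finZmodType) (m : nat) (zeta : algC)
    (f : G -> Zmod m) : Prop :=
  forall chi : 'CF([set: G]), chi \is a linear_char ->
    `|\sum_(x : G) zeta ^+ f x * chi x| ^+ 2 = #|G|%:R.

(* The underlying additive group of the integral group ring Z[C]: a function a stands for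
   the formal sum of the a(c) c. *)
Notation int_group_ring C := {ffun C -> int}.

Definition gr_elt (C : finGroupType) (c : C) : int_group_ring C :=
  [ffun d => (d == c)%:R].

Definition gr_extend (C : finGroupType) (tau : C -> algC)
    (a : int_group_ring C) : algC :=
  \sum_(c : C) (a c)%:~R * tau c.

(* f (x + y) - f y is computed in Z/mZ and used through its representative in
   [0, m), which is harmless when g has order m. *)
Definition autocorr (G : finZmodType) (m : nat) (f : G -> Zmod m)
    (C : finGroupType) (g : C) (x : G) : int_group_ring C :=
  \sum_(y : G) gr_elt (g ^+ (f (x + y) - f y)%R)%g.

(* Main.v *)
Require Import Defs.
From mathcomp Require Import all_boot all_order all_algebra all_fingroup.
From mathcomp Require Import all_solvable all_field all_character.
Import Order.TTheory GRing.Theory Num.Theory.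
Local Open Scope ring_scope.

(** The squared modulus of the Fourier transform of [u] is the Fourier
    transform of its autocorrelation [x |-> \sum_y u (x + y) * (u y)^*].  For a
    generalized bent [f] and [u = zeta ^+ f] this transform is constant, so by
    Fourier inversion the autocorrelation vanishes away from [0].  Finally
    [tau g] is a primitive [m]-th root of unity, hence a Galois conjugate of
    [zeta], and the vanishing is carried over by the conjugation. *)

(** In an abelian group centralizers are the whole group and conjugacy classes are singletons. *)
Lemma abelian_second_orthogonality (gT : finGroupType) (G : {group gT})
    (x y : gT) : abelian G -> x \in G -> y \in G ->
  \sum_(i : Iirr G) 'chi_i x * ('chi_i y)^* = #|G|%:R *+ (x == y).
Proof.
move=> abG Gx Gy; rewrite second_orthogonality_relation //.
have /setIidPl-> : (G \subset 'C[x])%g.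
  by rewrite sub_cent1 (subsetP abG).
suff -> : (y ^: G = [set y])%g by rewrite in_set1.
by apply/cent_classP; apply: (subsetP abG).
Qed.

(** Expanding the square as a double sum and writing the first variable as [z + y] produces
    [chi (z + y) * (chi y)^*], which is [chi z] because [chi y] has modulus 1. *)
Lemma sqr_norm_fourier (G : finZmodType) (u : G -> algC)
    (chi : 'CF([set: G])) : chi \is a linear_char ->
  `|\sum_y u y * chi y| ^+ 2 =
    \sum_z (\sum_y u (z + y) * (u y)^*) * chi z.
Proof.
move=> lin_chi; rewrite normCK rmorph_sum /= mulr_sumr.
under [RHS]eq_bigr do rewrite mulr_suml.
rewrite [RHS]exchange_big; apply: eq_bigr => y _ /=.
rewrite mulr_suml (reindex_inj (addIr y)); apply: eq_bigr => z _ /=.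
have -> : chi (z + y) = chi z * chi y by rewrite -(lin_charM lin_chi) ?inE.
rewrite rmorphM /= [LHS]mulrACA -[chi z * _ * _]mulrA.
by rewrite -normCK (normC_lin_char lin_chi) ?inE // expr1n mulr1.
Qed.

Lemma autocorrelation_eq0 (G : finZmodType) (u : G -> algC) (c : algC) :
    (forall chi : 'CF([set: G]), chi \is a linear_char ->
      `|\sum_y u y * chi y| ^+ 2 = c) ->
  forall x : G, x != 0 -> \sum_y u (x + y) * (u y)^* = 0.
Proof.
move=> flat_u x x_neq0; set A := fun z => \sum_y u (z + y) * (u y)^*.
have abG := FinRing.zmod_abelian [set: G].
have lin_chi (i : Iirr [set: G]) : 'chi_i \is a linear_char.
  exact: (char_abelianP _ abG).
(* With [c] expanded as the transform of [A], orthogonality keeps only the term [z = x]. *)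
have inversion : \sum_(i : Iirr [set: G]) c * ('chi_i x)^* = A x * #|G|%:R.
  transitivity (\sum_(i : Iirr [set: G]) \sum_z A z * ('chi_i z * ('chi_i x)^*)).
    apply: eq_bigr => i _.
    rewrite -(flat_u _ (lin_chi i)) sqr_norm_fourier // mulr_suml.
    by apply: eq_bigr => z _; rewrite mulrA.
  rewrite exchange_big /= (bigD1 x) //= [X in _ + X]big1 ?addr0.
    rewrite -mulr_sumr abelian_second_orthogonality ?inE //.
    by rewrite eqxx cardsT.
  move=> z z_neqx; rewrite -mulr_sumr abelian_second_orthogonality ?inE //.
  by rewrite (negPf z_neqx) mulr0.
(* Inserting ['chi_i 1%g = 1] turns this into orthogonality between [x] and the group identity,
   which is [0]. *)
have vanish : \sum_(i : Iirr [set: G]) c * ('chi_i x)^* = 0.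
  transitivity (\sum_(i : Iirr [set: G]) c * ('chi_i 1%g * ('chi_i x)^*)).
    by apply: eq_bigr => i _; rewrite lin_char1 // mul1r.
  rewrite -mulr_sumr abelian_second_orthogonality ?inE //.
  by rewrite eq_sym (negPf x_neq0) mulr0.
apply/eqP; move/eqP: inversion; rewrite vanish eq_sym mulf_eq0.
by rewrite pnatr_eq0 (cardD1 x) orbF.
Qed.

Lemma prim_expr_Zmod_sub (m : nat) (z : algC) (a b : Zmod m) :
  m.-primitive_root z -> z ^+ (a - b)%R = z ^+ a * (z ^+ b)^*.
Proof.
(* For a successor [m], the modulus [m.-1.+1] of [Zmod m] reduces to [m]. *)
case: m a b => [|m] a b prim_z; first by have := prim_order_gt0 prim_z.
have norm_z : `|z ^+ b| = 1.
  apply/eqP; rewrite -(pexpr_eq1 (prim_order_gt0 prim_z)) // -normrX exprAC.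
  by rewrite (prim_expr_order prim_z) expr1n normr1.
have zb_neq0 : z ^+ b != 0 by rewrite -normr_eq0 norm_z oner_eq0.
apply: (mulIf zb_neq0); rewrite -mulrA [_^* * _]mulrC -normCK norm_z.
rewrite expr1n mulr1 -exprD -(prim_expr_mod prim_z).
(* Read through [val], the identity [a - b + b = a] is a statement about exponents reduced modulo
   the order of [z]. *)
by have /(congr1 val)/= -> := subrK b a.
Qed.

(** Every element of [C] is a power of [g], so a power of [tau] that is 1 at [g] is trivial on
    [C]. *)
Lemma lin_char_generator_prim (gT : finGroupType) (C : {group gT}) (g : gT)
    (tau : 'CF(C)) : tau \is a linear_char -> generator C g ->
  #[tau]%CF.-primitive_root (tau g).
Proof.
move=> lin_tau /eqP genC.
have Cg : g \in C by rewrite genC cycle_id.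
have taugX : tau g ^+ #[tau]%CF = 1 by apply: (dvdn_cforderP _ g Cg).
have [k prim_k dvd_k] :=
  prim_order_exists (cforder_lin_char_gt0 lin_tau) taugX.
suff dvd_tau : (#[tau]%CF %| k)%N.
  by have/eqP-> : #[tau]%CF == k by rewrite eqn_dvd dvd_tau.
apply/dvdn_cforderP => h; rewrite {1}genC => /cycleP[i ->].
by rewrite (lin_charX lin_tau) // exprAC (prim_expr_order prim_k) expr1n.
Qed.

Lemma gr_extend_sum_elt (I : finType) (C : finGroupType) (tau : C -> algC)
    (h : I -> C) :
  gr_extend tau (\sum_i gr_elt (h i)) = \sum_i tau (h i).
Proof.
rewrite /gr_extend.
under eq_bigr do rewrite sum_ffunE rmorph_sum /= mulr_suml.
rewrite exchange_big; apply: eq_bigr => i _ /=.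
rewrite (bigD1 (h i)) //= ffunE eqxx mul1r big1 ?addr0 // => c c_neq.
by rewrite ffunE (negPf c_neq) mul0r.
Qed.

Theorem lemma2p5 (G : finZmodType) (m : nat) (m_gt0 : (0 < m)%N)
    (zeta : algC) (zeta_prim : m.-primitive_root zeta)
    (f : G -> Zmod m) (f_bent : generalized_bent zeta f)
    (C : finGroupType) (g : C) (C_card : #|C| = m)
    (g_gen : generator [set: C] g)
    (tau : 'CF([set: C])) (tau_char : tau \is a linear_char)
    (tau_order : #[tau]%CF = m) (x : G) (x_neq0 : x != 0) :
  gr_extend tau (autocorr f g x) = 0.
Proof.
rewrite gr_extend_sum_elt.
under eq_bigr do rewrite (lin_charX tau_char) ?inE //.
have := lin_char_generator_prim _ _ _ _ tau_char g_gen.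
rewrite tau_order => taug_prim.
have [k taugE] := prim_rootP zeta_prim (prim_expr_order taug_prim).
(* Primitivity of [tau g = zeta ^+ k] makes [k] a unit modulo [m], so some [s] acts on [m]-th roots
   of unity as the [k]-th power. *)
have co_k : coprime k m by rewrite -(prim_root_exp_coprime _ zeta_prim) -taugE.
have [s sE] := Qn_aut_exists co_k.
have s_zeta : s zeta = tau g by rewrite sE ?(prim_expr_order zeta_prim).
under eq_bigr do
  rewrite -s_zeta -rmorphXn /= (prim_expr_Zmod_sub _ _ _ _ zeta_prim).
by rewrite -rmorph_sum (autocorrelation_eq0 _ _ _ f_bent) ?rmorph0.
Qed.
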